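(* Fix a real number $0<p<1$ and an integer $t\ge 0$, and set $b:=1/(1-p)$. Let $\alpha_t^{(k)}(G)$ denote the number of $t$-stable sets of order $k$ contained in a graph $G$. If $k=k(n)$ is a sequence of positive integers with $k=O(\ln n)$ and $k\to\infty$ as $n\to\infty$, then \[ \mathbb{E}\big(\alpha_t^{(k)}(G_{n,p})\big) = \left( e^2 n^2 b^{-k+1} k^{t-2} \left(\frac{tbp}{e}\right)^t \frac{1}{t!^2}\right)^{k/2} (1+o(1))^k , \] where the $o(1)$ term is a function of $n$ tending to $0$ as $n\to\infty$.
   Context: For a graph $G=(V,E)$, a vertex subset $S\subseteq V$ is called $t$-stable if the induced subgraph $G[S]$ has maximum degree at most $t$. $G_{n,p}$ is the random graph on vertex set $V_n=\{1,\dots,n\}$ in which each pair of distinct vertices is an edge with probability $p$, independently of all other pairs. Convention: $0^0=1$. *)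

(* Defs.v *)
From mathcomp Require Import all_boot all_order all_algebra.
From mathcomp Require Import reals.

Set Implicit Arguments.
Unset Strict Implicit.
Unset Printing Implicit Defensive.

Import Order.TTheory GRing.Theory Num.Theory.

Local Open Scope ring_scope.

Section Graphs.
Variable V : finType.

Definition vpair := {e : {set V} | #|e| == 2%N}.

(* A simple graph on V is identified with its edge set. *)
Definition graph := {set vpair}.

Implicit Types (G : graph) (S : {set V}) (u v : V).

(* Irreflexive, since [set u; u] has only one element. *)
Definition adj G u v : bool := [exists e in G, val e == [set u; v]]%SET.

Definition degree G v : nat := #|[set u | adj G v u]%SET|.

(* The edges of G[S]; the vertex set S of G[S] is passed along separately. *)
Definition induced_graph G S : graph := [set e in G | val e \subset S]%SET.

Definition induced_max_degree G S : nat :=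
  \max_(v in S) degree (induced_graph G S) v.

Definition t_stable (t : nat) G S : bool := (induced_max_degree G S <= t)%N.

Definition alpha (t k : nat) G : nat :=
  #|[set S : {set V} | (#|S| == k) && t_stable t G S]%SET|.

End Graphs.

Section RandomGraph.
Variables (R : realType) (n : nat) (p : R).

(* The law of the random graph with n vertices and independent edges of
   probability p, as a mass function on the graphs on 'I_n. *)
Definition gnp (G : graph 'I_n) : R :=
  \prod_(e : vpair 'I_n) (if e \in G then p else 1 - p).

Definition gnp_expectation (X : graph 'I_n -> R) : R :=
  \sum_(G : graph 'I_n) gnp G * X G.

Lemma gnp_ge0 (G : graph 'I_n) : 0 <= p <= 1 -> 0 <= gnp G.
Proof.
move=> /andP[p0 p1]; apply: prodr_ge0 => e _.
by case: ifP => // _; rewrite subr_ge0.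
Qed.

(* The edge events are independent of probability p; A = B = set0 says that
   gnp has total mass 1. *)
Lemma gnp_indep (A B : graph 'I_n) : [disjoint A & B] ->
  \sum_(G : graph 'I_n | (A \subset G) && [disjoint B & G]) gnp G
  = p ^+ #|A| * (1 - p) ^+ #|B|.
Proof.
move=> dAB.
pose F e := if e \in B then 0 else p.
pose H e := if e \in A then 0 else 1 - p.
transitivity (\sum_(G : graph 'I_n) \prod_e (if e \in G then F e else H e)).
  rewrite big_mkcond /=; apply: eq_bigr => G _; case: ifPn.
    move=> /andP[/fintype.subsetP AG BG]; apply: eq_bigr => e _.
    case: ifPn => eG; rewrite /F /H; first by rewrite (disjointFl BG eG).
    by case: ifPn => // /AG eA; rewrite eA in eG.
  rewrite negb_and => /orP[/subsetPn[e eA eG]|].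
    by rewrite (bigD1 e) //= (negbTE eG) /H eA mul0r.
  rewrite disjoint_subset => /subsetPn[e eB]; rewrite !inE negbK => eG.
  by rewrite (bigD1 e) //= eG /F eB mul0r.
rewrite -bigA_distr -!prodr_const (bigID (mem A)) /=; congr (_ * _).
  by apply: eq_bigr => e eA; rewrite /F /H eA (disjointFr dAB eA) addr0.
rewrite [LHS](bigID (mem B)) /= [X in _ * X]big1 ?mulr1.
  apply: eq_big => [e|e /andP[eA eB]].
    case eB: (e \in B); rewrite ?andbF // andbT.
    by rewrite (disjointFl dAB eB).
  by rewrite /F /H (negbTE eA) eB add0r.
by move=> e /andP[eA eB]; rewrite /F /H (negbTE eA) (negbTE eB) subrKC.
Qed.

End RandomGraph.

(* Main.v *)
(** Give a graph H on k vertices the weight w(H) = prod_v t(t-1)...(t-deg v+1).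
    It vanishes unless H has maximum degree at most t, and adding a new edge uv
    multiplies it by (t - deg u)(t - deg v).  Let W_m be the total weight of the
    graphs with m edges and r = tk - 2m the number of free slots.  Counting pairs
    (graph, edge) and summing (t - deg u)(t - deg v) over the non-edges gives
      r (r - t - t^2) W_m <= 2 (m+1) W_(m+1) <= r^2 W_m,
    so W_m is of order (tk)! / (m! 2^m (tk - 2m)!) up to factors polynomial in k.
    As w(H) lies between t!^k / t^(tk - 2m) and t!^k, the sum of (p/(1-p))^|E(H)|
    over the graphs H of maximum degree at most t is
      (tkp / (e(1-p)))^(tk/2) t!^(-k) exp(O(sqrt k)).
    The upper bound comes from bounding each term x^m/m! by exp x at the scale
    where the terms of the sum are largest.  The expectation is this sum times
    'C(n, k) (1-p)^'C(k, 2), and k = O(ln n) makes 'C(n, k) = (en/k)^k exp(o(k)). *)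
Require Import Defs.
From mathcomp Require Import all_boot all_order all_algebra.
From mathcomp Require Import reals zify ring lra.

Import Order.TTheory GRing.Theory Num.Theory.

Set Implicit Arguments.
Unset Strict Implicit.
Unset Printing Implicit Defensive.

(** * Sums over edges and degrees *)

Section Combinatorics.
Variable V : finType.
Implicit Types (e : vpair V) (H : graph V) (S : {set V}) (a F : V -> nat).

(** The map u |-> {v, u} is a bijection from the vertices other than v onto the edges at v. [F]
    takes sets and not edges, so that the right side carries no proof that {v, u} has two
    elements. *)
Lemma sum_pairs_at v (F : {set V} -> nat) :
  \sum_(e : vpair V | v \in val e) F (val e) = \sum_(u | u != v) F [set v; u].
Proof.
transitivity (\sum_(A in [set [set v; u] | u in [set~ v]]) F A); last first.
  rewrite big_imset /=; last first.
    move=> u1 u2; rewrite !inE => n1 n2 E.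
    have := set22 v u1; rewrite E !inE => /orP[/eqP E1|/eqP//].
    by rewrite E1 eqxx in n1.
  by apply: eq_bigl => u; rewrite !inE.
transitivity (\sum_(A : {set V} | (#|A| == 2) && (v \in A)) F A).
  by rewrite (big_sub_cond [pred A : {set V} | #|A| == 2]).
apply: eq_bigl => A; apply/andP/imsetP.
  move=> [/cards2P[x [y [nxy ->]]]]; rewrite !inE => /orP[]/eqP->.
    by exists y; rewrite // !inE eq_sym.
  by exists x; rewrite 1?setUC // !inE.
by move=> [u]; rewrite !inE => nuv ->; rewrite cards2 (eq_sym v) nuv !inE eqxx.
Qed.

Lemma card_edge e : #|val e| = 2. Proof. exact/eqP/(valP e). Qed.

Lemma degreeE H v : degree H v = \sum_(e in H) (v \in val e).
Proof.
rewrite /degree -sum1dep_card.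
transitivity (\sum_(u | u != v) ([set v; u] \in [set val e | e in H] : nat)).
  rewrite [RHS]big_mkcond [LHS]big_mkcond; apply: eq_bigr => u _.
  have -> : adj H v u = ([set v; u] \in [set val e | e in H]).
    apply/existsP/imsetP => -[e]; first by move=> /andP[eH /eqP<-]; exists e.
    by move=> eH E; exists e; rewrite eH E eqxx.
  case: eqVneq => [->|_] /=; last by case: (_ \in _).
  case: imsetP => //= -[e eH E].
  have : #|[set v; v]| = 2 by rewrite E; apply: card_edge.
  by rewrite setUid cards1.
rewrite -(sum_pairs_at v (fun A => (A \in [set val e | e in H]) : nat)).
rewrite [LHS]big_mkcond [RHS]big_mkcond; apply: eq_bigr => e _.
rewrite (mem_imset _ _ val_inj).
by case: (v \in _); case: (e \in H).
Qed.

Lemma degreeU1 H e v : e \notin H ->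
  degree (e |: H) v = (v \in val e) + degree H v.
Proof. by move=> eH; rewrite !degreeE big_setU1. Qed.

(** A graph on S is represented as a graph on V with edges in [edges_in S], so that all vertex sets
    S share one ambient type. *)
Definition edges_in S : graph V := [set e : vpair V | val e \subset S].

Lemma induced_graphE G S : induced_graph G S = G :&: edges_in S.
Proof. by apply/setP=> e; rewrite !inE. Qed.

Lemma card_edges_in S : #|edges_in S| = 'C(#|S|, 2).
Proof.
rewrite -cards_draws -(card_imset _ val_inj); apply: eq_card => A.
rewrite inE; apply/imsetP/andP => [[e]|[AS A2]].
  by rewrite inE => eS ->; rewrite eS (valP e).
by exists (Sub A A2); rewrite ?inE SubK.
Qed.

Lemma sum_endpoints e S a : e \in edges_in S ->
  \sum_(v in S) (v \in val e) * a v = \sum_(v in val e) a v.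
Proof.
rewrite inE => /subsetP eS; rewrite [LHS]big_mkcond [RHS]big_mkcond.
apply: eq_bigr => v _; case: (boolP (v \in val e)) => [/eS->|]; rewrite ?mul1n //.
by case: ifP.
Qed.

Lemma sum_degree_weighted H S a : H \subset edges_in S ->
  \sum_(v in S) degree H v * a v = \sum_(e in H) \sum_(v in val e) a v.
Proof.
move=> /subsetP HS.
under eq_bigr do rewrite degreeE big_distrl /=.
rewrite exchange_big /=; apply: eq_bigr => e /HS; exact: sum_endpoints.
Qed.

Lemma sum_degree H S : H \subset edges_in S ->
  \sum_(v in S) degree H v = 2 * #|H|.
Proof.
move=> HS; have := sum_degree_weighted (fun=> 1) HS.
under eq_bigr do rewrite muln1; move=> ->.
rewrite -[RHS]mulnC -sum_nat_const; apply: eq_bigr => e _.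
by rewrite sum1_card; apply: card_edge.
Qed.

Lemma prod_pair e a : exists u v, [/\ u != v, val e = [set u; v],
  \prod_(x in val e) a x = a u * a v & \sum_(x in val e) a x = a u + a v].
Proof.
have /cards2P[u [v [nuv E]]] := valP e; exists u, v; split=> //.
  by rewrite E big_setU1 ?inE //= big_set1.
by rewrite E big_setU1 ?inE //= big_set1.
Qed.

(** Expanding the square over ordered pairs, the diagonal gives the squares and every edge is met
    twice. *)
Lemma sum_edges_in S a :
  2 * \sum_(e in edges_in S) \prod_(x in val e) a x + \sum_(v in S) a v ^ 2
  = (\sum_(v in S) a v) ^ 2.
Proof.
transitivity (\sum_(v in S) \sum_(u in S) a v * a u); last first.
  by rewrite -mulnn big_distrl; apply: eq_bigr => v _; rewrite big_distrr.
have E2 : 2 * \sum_(e in edges_in S) \prod_(x in val e) a x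
    = \sum_(v in S) \sum_(e : vpair V | v \in val e)
        (val e \subset S) * \prod_(x in val e) a x.
  rewrite (exchange_big_dep xpredT) //= big_distrr /= big_mkcond /=.
  apply: eq_bigr => e _; rewrite inE.
  case: ifPn => [/subsetP eS|_]; last by rewrite big1 // => v _; rewrite mul0n.
  rewrite mul1n big_mkcondl /=.
  under [RHS]eq_bigr => v ve do rewrite (eS _ ve).
  by rewrite sum_nat_const; congr (_ * _); rewrite card_edge.
rewrite E2 -big_split /=; apply: eq_bigr => v vS.
rewrite (sum_pairs_at v (fun A => (A \subset S) * \prod_(x in A) a x)).
rewrite [RHS](bigD1 v) //= addnC mulnn; congr (_ + _).
rewrite [LHS]big_mkcond [RHS]big_mkcond; apply: eq_bigr => u _.
case: eqVneq => [_|nuv]; rewrite ?andbF // andbT.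
rewrite subUset !sub1set vS /=; case: (u \in S) => //.
by rewrite mul1n big_setU1 ?inE 1?eq_sym //= big_set1.
Qed.

End Combinatorics.

(** * Weighted counting of graphs of bounded degree *)

Section Weight.
Variables (V : finType) (t : nat) (S : {set V}).
Implicit Types (e : vpair V) (H : graph V).

(* The number of ways to choose, at every vertex, distinct slots among t for the
   edges of H. *)
Definition weight H : nat := \prod_(v in S) t ^_ (degree H v).

Definition bounded_degree H : bool := [forall v in S, degree H v <= t].

Lemma weight_eq0 H : ~~ bounded_degree H -> weight H = 0.
Proof.
rewrite negb_forall_in => /exists_inP[v vS]; rewrite -ltnNge => lt.
by rewrite /weight (bigD1 v) //= ffact_small.
Qed.

(** Only the two endpoints change degree, and t^_(d+1) = t^_d (t - d). This holds for d >= t as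
    well, where truncated subtraction makes both sides 0. *)
Lemma weightU1 H e : e \in edges_in S -> e \notin H ->
  weight (e |: H) = weight H * \prod_(v in val e) (t - degree H v).
Proof.
rewrite inE => /subsetP eS eH.
transitivity (\prod_(v in S) (t ^_ (degree H v)
    * if v \in val e then t - degree H v else 1)).
  apply: eq_bigr => v _; rewrite degreeU1 //.
  by case: (v \in val e); rewrite ?muln1 // add1n ffactnSr.
rewrite big_split /=; congr (_ * _).
rewrite -big_mkcondr /=; apply: eq_bigl => v.
by case: (boolP (v \in val e)) => [/eS->|]; rewrite ?andbF.
Qed.

Lemma weight_le H : weight H <= t`! ^ #|S|.
Proof.
rewrite -prod_nat_const; apply: leq_prod => v _.
have [dt|dt] := leqP (degree H v) t; last by rewrite ffact_small.
by rewrite -(ffact_fact dt) leq_pmulr // fact_gt0.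
Qed.

Lemma sum_free H : H \subset edges_in S -> bounded_degree H ->
  \sum_(v in S) (t - degree H v) + 2 * #|H| = t * #|S|.
Proof.
move=> HS /forall_inP Ht; rewrite -(sum_degree HS) -big_split /= mulnC.
by rewrite -sum_nat_const; apply: eq_bigr => v vS; rewrite subnK ?Ht.
Qed.

(** At a vertex of degree d, t! = t^_d (t - d)! <= t^_d t^(t-d), and by the handshake count the
    exponents t - d add up to the number of free slots. *)
Lemma weight_ge H : H \subset edges_in S -> bounded_degree H ->
  t`! ^ #|S| <= weight H * t ^ (t * #|S| - 2 * #|H|).
Proof.
move=> HS Ht; rewrite -(sum_free HS Ht) addnK expn_sum -big_split /=.
rewrite -prod_nat_const; apply: leq_prod => v vS.
have dt := forall_inP Ht v vS.
rewrite -{1}(ffact_fact dt) leq_mul2l; apply/orP; right.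
have : t - degree H v <= t by rewrite leq_subr.
elim: (t - degree H v) => // j IH jt.
by rewrite factS expnS leq_mul // IH // ltnW.
Qed.

Lemma sum_nonedges_le H :
  2 * \sum_(e in edges_in S :\: H) \prod_(v in val e) (t - degree H v)
  <= (\sum_(v in S) (t - degree H v)) ^ 2.
Proof.
rewrite -sum_edges_in; apply: leq_trans (leq_addr _ _).
by rewrite leq_mul2l /= [leqRHS](big_setID H) leq_addl.
Qed.

(** In the expansion of r^2 the diagonal takes at most t r and the edges of H at most t^2 r; what is
    left belongs to the non-edges. *)
Lemma sum_nonedges_ge H (r := \sum_(v in S) (t - degree H v)) :
  H \subset edges_in S -> bounded_degree H ->
  r * (r - (t + t ^ 2))
  <= 2 * \sum_(e in edges_in S :\: H) \prod_(v in val e) (t - degree H v).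
Proof.
move=> HS Ht; set X := \sum_(e in _) _.
have := sum_edges_in S (fun v => t - degree H v).
rewrite (big_setID H) /= -/X -/r (setIidPr HS).
set Y := \sum_(e in H) _; set Z := \sum_(v in S) _ => E.
have hZ : Z <= t * r.
  rewrite big_distrr; apply: leq_sum => v _.
  by rewrite -mulnn leq_mul2r leq_subr orbT.
have hY : 2 * Y <= t ^ 2 * r.
  apply: (@leq_trans (t * \sum_(v in S) degree H v * (t - degree H v))).
    rewrite sum_degree_weighted // !big_distrr /=; apply: leq_sum => e _.
    have [u [v [_ _ -> ->]]] := prod_pair e (fun v => t - degree H v).
    (* Both free counts a, b are at most t, hence 2ab <= t(a + b). *)
    by have := leq_subr (degree H u) t; have := leq_subr (degree H v) t; nia.
  rewrite -mulnn -mulnA leq_mul2l; apply/orP; right.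
  rewrite big_distrr; apply: leq_sum => v vS.
  by rewrite leq_mul2r (forall_inP Ht v vS) orbT.
nia.
Qed.

(** The W_m of the overview. No degree bound is imposed, since graphs that violate it have weight
    0. *)
Definition total_weight m : nat :=
  \sum_(H : graph V | (H \subset edges_in S) && (#|H| == m)) weight H.

(** Double counting of pairs of a graph with m + 1 edges and one of its edges e: deleting e leaves a
    graph with m edges and a non-edge, and [weightU1] gives the change of weight. *)
Lemma total_weightS m :
  m.+1 * total_weight m.+1
  = \sum_(H : graph V | (H \subset edges_in S) && (#|H| == m))
      weight H * \sum_(e in edges_in S :\: H) \prod_(v in val e) (t - degree H v).
Proof.
transitivity (\sum_(H : graph V | (H \subset edges_in S) && (#|H| == m.+1))
                \sum_(e in H) weight H).
  rewrite big_distrr /=; apply: eq_bigr => H /andP[_ /eqP Hm].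
  by rewrite sum_nat_const Hm.
rewrite (exchange_big_dep (mem (edges_in S))) /=; last first.
  by move=> H e /andP[/subsetP HS _] /HS.
transitivity (\sum_(e in edges_in S)
    \sum_(H : graph V | [&& H \subset edges_in S, #|H| == m & e \notin H])
      weight (e |: H)).
  apply: eq_bigr => e eS.
  (* Adding and deleting e are mutually inverse between the graphs without e and those with e. *)
  rewrite (reindex_onto (fun H => e |: H) (fun H => H :\ e)) /=; last first.
    by move=> H /andP[_ eH]; rewrite setD1K.
  apply: eq_bigl => H; rewrite setU11 andbT subUset sub1set eS /= -andbA.
  congr (_ && _); case: (boolP (e \in H)) => eH /=.
    rewrite andbF; apply/negbTE; rewrite negb_and; apply/orP; right.
    by apply/eqP => E; have := setD11 e (e |: H); rewrite E eH.
  by rewrite setU1K // eqxx andbT cardsU1 eH add1n eqSS andbT.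
rewrite (exchange_big_dep [pred H : graph V | (H \subset edges_in S) && (#|H| == m)]) /=; last first.
  by move=> e H _ /and3P[-> ->].
apply: eq_bigr => H /andP[HS Hm]; rewrite big_distrr /=.
apply: eq_big => [e|e /and3P[eS _ /andP[_ eH]]]; last exact: weightU1.
by rewrite !inE HS Hm /= andbC.
Qed.

Lemma total_weight_step_le m : 2 * m <= t * #|S| ->
  2 * (m.+1 * total_weight m.+1) <= (t * #|S| - 2 * m) ^ 2 * total_weight m.
Proof.
move=> mt; rewrite total_weightS !big_distrr /=.
apply: leq_sum => H /andP[HS /eqP Hm].
case: (boolP (bounded_degree H)) => Ht; last by rewrite weight_eq0 ?muln0.
have := sum_nonedges_le H; have := sum_free HS Ht; rewrite Hm.
set X := \sum_(e in _ :\: _) _; set r := \sum_(v in S) _ => <-; rewrite addnK.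
by move=> h; rewrite mulnCA mulnC leq_mul2r h orbT.
Qed.

Lemma total_weight_step_ge m :
  (t * #|S| - 2 * m) * (t * #|S| - 2 * m - (t + t ^ 2)) * total_weight m
  <= 2 * (m.+1 * total_weight m.+1).
Proof.
rewrite total_weightS !big_distrr /=.
apply: leq_sum => H /andP[HS /eqP Hm].
case: (boolP (bounded_degree H)) => Ht; last by rewrite weight_eq0 ?muln0.
have /= := sum_nonedges_ge HS Ht; have := sum_free HS Ht; rewrite Hm.
set X := \sum_(e in _ :\: _) _; set r := \sum_(v in S) _ => <-; rewrite addnK.
by move=> h; rewrite mulnCA mulnC leq_mul2l h orbT.
Qed.

Lemma total_weight0 : total_weight 0 = 1.
Proof.
rewrite /total_weight (big_pred1 set0) => [|H]; last first.
  rewrite cards_eq0 andb_idl // => /eqP->; exact: sub0set.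
rewrite /weight big1 // => v _.
by rewrite degreeE big_set0.
Qed.

(** Each step contributes a factor r^2 <= (r + 1) r, and over r = N, N - 2, ... these products
    telescope to (N + 1)! / (N - 2m + 1)!. This explains the shift by one in the factorials. *)
Lemma total_weight_le m : 2 * m <= t * #|S| ->
  total_weight m * (m`! * 2 ^ m) * (t * #|S| - 2 * m).+1`! <= (t * #|S|).+1`!.
Proof.
elim: m => [|m IH] hm; first by rewrite total_weight0 muln0 subn0 !mul1n.
apply: leq_trans (IH _); last by lia.
have := @total_weight_step_le m ltac:(lia).
set N := t * #|S| in hm *.
have -> : N - 2 * m = (N - 2 * m.+1).+2 by lia.
set r := N - 2 * m.+1; rewrite !factS (expnS 2 m).
set f := m`!; set g := r`!; set h := 2 ^ m.
set A := total_weight m.+1; set B := total_weight m => le.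
have : 2 * (m.+1 * A) * (f * h * (r.+1 * g))
    <= r.+2 ^ 2 * B * (f * h * (r.+1 * g)) by rewrite leq_mul2r le orbT.
move/leq_trans; have -> : A * (m.+1 * f * (2 * h)) * (r.+1 * g)
  = 2 * (m.+1 * A) * (f * h * (r.+1 * g)) by ring.
apply.
have -> : B * (f * h) * (r.+3 * (r.+2 * (r.+1 * g)))
  = r.+3 * r.+2 * B * (f * h * (r.+1 * g)) by ring.
rewrite leq_mul2r; apply/orP; right; rewrite leq_mul2r; apply/orP; right.
by rewrite -mulnn leq_mul2r leqnSn orbT.
Qed.

(** With s = M - 2m, the step factor r (r - t - t^2) is at least (s - 1) s, because r - t - t^2 = s
    and r >= s - 1. These products telescope to M! / (M - 2m)!. *)
Lemma total_weight_ge m : let M := t * #|S| - (t + t ^ 2) in 2 * m <= M ->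
  M`! <= total_weight m * (m`! * 2 ^ m) * (M - 2 * m)`!.
Proof.
move=> M; elim: m => [|m IH] hm; first by rewrite total_weight0 muln0 subn0 !mul1n.
apply: leq_trans (IH _) _; first by lia.
have := total_weight_step_ge m.
set N := t * #|S| in M hm IH *.
have [-> E2] : N - 2 * m - (t + t ^ 2) = (M - 2 * m.+1).+2 /\
  (M - 2 * m.+1).+1 <= N - 2 * m by rewrite /M in hm *; lia.
have -> : M - 2 * m = (M - 2 * m.+1).+2 by lia.
set r := M - 2 * m.+1 in E2 *; set q := N - 2 * m in E2 *; rewrite !factS (expnS 2 m).
set f := m`!; set g := r`!; set h := 2 ^ m.
set A := total_weight m.+1; set B := total_weight m => le.
have -> : A * (m.+1 * f * (2 * h)) * g = 2 * (m.+1 * A) * (f * h * g) by ring.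
have -> : B * (f * h) * (r.+2 * (r.+1 * g)) = r.+1 * r.+2 * B * (f * h * g) by ring.
rewrite leq_mul2r; apply/orP; right; apply: leq_trans le.
by rewrite leq_mul2r leq_mul2r E2 !orbT.
Qed.

End Weight.

Local Open Scope ring_scope.

(** * The expected count as a sum over k-sets *)

Section StableSum.
Variables (R : realType) (V : finType).
Implicit Types (lam p : R) (t : nat) (S : {set V}) (H G : graph V).

(** For lam = p / (1 - p) this is the probability that S is t-stable, divided by (1 - p)^'C(#|S|,
    2). *)
Definition stable_sum lam t S : R :=
  \sum_(H : graph V | (H \subset edges_in S) && bounded_degree t S H) lam ^+ #|H|.

Lemma t_stableE t G S : t_stable t G S = bounded_degree t S (G :&: edges_in S).
Proof. by rewrite -induced_graphE; apply/bigmax_leqP/forall_inP. Qed.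

(** The graphs with exactly m edges suffice: each has weight at most t!^#|S|, and weight 0 if its
    degrees are not bounded by t. *)
Lemma stable_sum_lower lam t S m : 0 < lam ->
  lam ^+ m * (total_weight t S m)%:R <= stable_sum lam t S * t`!%:R ^+ #|S|.
Proof.
move=> lam0; rewrite /total_weight natr_sum big_distrl big_distrr /=.
rewrite [leLHS]big_mkcond [leRHS]big_mkcond; apply: ler_sum => H _.
have pos : 0 <= lam ^+ #|H| * t`!%:R ^+ #|S| :> R.
  by rewrite mulr_ge0 ?exprn_ge0 // ltW.
case: ifP => [/andP[-> /eqP Hm] /=|_]; last by case: ifP.
case: ifPn => [_|Ht]; last by rewrite weight_eq0 ?mulr0.
by rewrite -Hm -natrX ler_pM2l ?exprn_gt0 // ler_nat weight_le.
Qed.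

End StableSum.

Section Expectation.
Variables (R : realType) (n : nat) (p : R).

(** Linearity of expectation, followed by a split of the event that S is t-stable according to the
    graph H that G induces on S. *)
Lemma expectation_alpha t k : 0 < p < 1 ->
  gnp_expectation p (fun G : graph 'I_n => (alpha t k G)%:R)
  = \sum_(S : {set 'I_n} | #|S| == k)
      (1 - p) ^+ 'C(k, 2) * stable_sum (p / (1 - p)) t S.
Proof.
move=> /andP[p0 p1].
have q0 : 1 - p != 0 by rewrite subr_eq0 eq_sym lt_eqF.
rewrite /gnp_expectation.
transitivity (\sum_(S : {set 'I_n} | #|S| == k)
    \sum_(G : graph 'I_n | t_stable t G S) gnp p G).
  transitivity (\sum_(G : graph 'I_n) \sum_(S : {set 'I_n} | (#|S| == k) && t_stable t G S) gnp p G).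
    apply: eq_bigr => G _; rewrite /alpha sumr_const mulr_natr.
    by congr (_ *+ _); apply: eq_card => S; rewrite !inE.
  rewrite (exchange_big_dep (fun S : {set 'I_n} => #|S| == k)) /=; last first.
    by move=> G S _ /andP[].
  by apply: eq_bigr => S hS; apply: eq_bigl => G; rewrite hS.
apply: eq_bigr => S /eqP hS.
rewrite (partition_big (fun G => G :&: edges_in S)
  (fun H => (H \subset edges_in S) && bounded_degree t S H)) /=; last first.
  by move=> G; rewrite t_stableE => ->; rewrite subsetIr.
rewrite /stable_sum big_distrr /=; apply: eq_bigr => H /andP[HS Ht].
(* G induces H on S exactly when it contains H and avoids all other edges inside S; [gnp_indep]
   gives the probability of this. *)
transitivity (\sum_(G : graph 'I_n | (H \subset G) && [disjoint edges_in S :\: H & G]) gnp p G).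
  apply: eq_bigl => G; rewrite t_stableE; apply/andP/andP => [[_ /eqP<-]|[HG dG]].
    rewrite subsetIl; split=> //; rewrite disjoints_subset.
    by apply/fintype.subsetP => e; rewrite !inE => /andP[+ eS]; rewrite eS andbT.
  suff -> : G :&: edges_in S = H by rewrite eqxx Ht.
  apply/eqP; rewrite eqEsubset subsetI HG HS !andbT.
  apply/fintype.subsetP => e /setIP[eG eS]; apply: contraLR eG => eH.
  by rewrite (disjointFr dG) // inE eH.
rewrite gnp_indep; last by rewrite disjoint_sym disjoints_subset setDE subsetIr.
have := cardsID H (edges_in S); rewrite (setIidPr HS) card_edges_in hS => <-.
by rewrite exprD exprMn exprVn [RHS]mulrC mulrA divfK ?expf_neq0.
Qed.

End Expectation.

From mathcomp Require Import all_classical all_reals all_analysis.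

Import numFieldNormedType.Exports.

Local Open Scope classical_set_scope.
Local Open Scope ring_scope.

(** * Logarithmic asymptotics *)

Section StableSumBounds.
Variable R : realType.

Lemma exprn_divfact_le_expR (x : R) m : 0 <= x -> x ^+ m / m`!%:R <= expR x.
Proof.
case: m => [|m] x0; first by rewrite expr0 fact0 divr1 -expR0 ler_expR.
by apply: le_trans (expR_ge1Dxn m x0); rewrite lerDr.
Qed.

(* Term m of the sum, times y^N, is at most (N+1)! times
   ((lam y^2 / 2)^m / m!) ((t y)^(N-2m) / (N-2m)!). *)
Lemma stable_sum_upper (V : finType) (lam y : R) t (S : {set V})
    (N := (t * #|S|)%N) : 0 < lam -> 0 < y ->
  stable_sum lam t S * t`!%:R ^+ #|S| * y ^+ N
  <= N.+1%:R * N.+1`!%:R * expR (lam * y ^+ 2 / 2 + t%:R * y).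
Proof.
move=> lam0 y0.
pose term m : R := lam ^+ m * t%:R ^+ (N - 2 * m) * (total_weight t S m)%:R.
(* By [weight_ge], t!^#|S| is replaced by weight times t^(free slots), so the sum over graphs
   becomes a sum of total weights. *)
have le1 : stable_sum lam t S * t`!%:R ^+ #|S|
    <= \sum_(m < N.+1 | (2 * m <= N)%N) term m.
  rewrite /stable_sum big_distrl /=.
  apply: (@le_trans _ _ (\sum_(H : graph V | (H \subset edges_in S) && bounded_degree t S H)
    lam ^+ #|H| * t%:R ^+ (N - 2 * #|H|) * (weight t S H)%:R)).
    apply: ler_sum => H /andP[HS Ht].
    rewrite -mulrA ler_pM2l ?exprn_gt0 // mulrC -!natrX -natrM ler_nat.
    exact: weight_ge.
  (* This bound ensures that [inord #|H|] has value #|H| and not its default 0. *)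
  have HN (H : graph V) : (H \subset edges_in S) && bounded_degree t S H -> (2 * #|H| <= N)%N.
    by case/andP=> HS Ht; rewrite /N -(sum_free HS Ht) leq_addl.
  rewrite (partition_big (fun H : graph V => inord #|H| : 'I_N.+1)
    (fun m : 'I_N.+1 => (2 * m <= N)%N)) /=; last first.
    by move=> H /HN hH; rewrite inordK // ltnS (leq_trans _ hH) // leq_pmull.
  apply: ler_sum => m hm; rewrite /term /total_weight natr_sum big_distrr /=.
  rewrite [leLHS]big_mkcond [leRHS]big_mkcond; apply: ler_sum => H _.
  have pos : 0 <= lam ^+ m * t%:R ^+ (N - 2 * m) * (weight t S H)%:R :> R.
    by rewrite !mulr_ge0 // exprn_ge0 // ltW.
  case: ifP => [/andP[hH /eqP Hm]|_]; last by case: ifP.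
  have Em : #|H| = m by rewrite -Hm inordK // ltnS (leq_trans _ (HN _ hH)) // leq_pmull.
  by rewrite Em eqxx (proj1 (andP hH)).
apply: (@le_trans _ _ ((\sum_(m < N.+1 | (2 * m <= N)%N) term m) * y ^+ N)).
  by rewrite ler_wpM2r // exprn_ge0 // ltW.
rewrite big_distrl /=.
apply: (@le_trans _ _ (\sum_(m < N.+1) N.+1`!%:R * expR (lam * y ^+ 2 / 2 + t%:R * y))); last first.
  by rewrite sumr_const card_ord -[N.+1%:R * _ * _]mulrA [leRHS]mulr_natl lexx.
rewrite [leLHS]big_mkcond; apply: ler_sum => m _.
case: ifP => hm; last by rewrite mulr_ge0 // expR_ge0.
have := total_weight_le hm; rewrite -/N.
set W := total_weight t S m; set D := (N - 2 * m)%N.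
have ND : N = (2 * m + D)%N by rewrite /D subnKC.
move=> hW.
set x1 := lam * y ^+ 2 / 2; set x2 := t%:R * y.
have x10 : 0 <= x1 by rewrite /x1 !mulr_ge0 ?invr_ge0 ?exprn_ge0 // ltW.
have x20 : 0 <= x2 by rewrite /x2 mulr_ge0 // ltW.
have e1 := exprn_divfact_le_expR m x10.
have e2 := exprn_divfact_le_expR D x20.
rewrite expRD.
apply: (@le_trans _ _ (N.+1`!%:R * ((x1 ^+ m / m`!%:R) * (x2 ^+ D / D`!%:R)))); last first.
  rewrite ler_wpM2l //; apply: ler_pM => //; rewrite mulr_ge0 ?exprn_ge0 ?invr_ge0 //.
have fm : (m`!%:R : R) != 0 by rewrite pnatr_eq0 -lt0n fact_gt0.
have fD : (D`!%:R : R) != 0 by rewrite pnatr_eq0 -lt0n fact_gt0.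
(* The N factors y are shared out: 2m of them join lam^m, the other N - 2m join the powers of t. *)
have -> : term m * y ^+ N = W%:R * (m`!%:R * 2 ^+ m * D`!%:R)
    * ((x1 ^+ m / m`!%:R) * (x2 ^+ D / D`!%:R)).
  have -> : y ^+ N = y ^+ (2 * m + D) by congr (_ ^+ _).
  rewrite /term -/D -/W exprD exprM /x1 /x2 !exprMn exprVn.
  by field; rewrite fm fD expf_neq0.
rewrite ler_wpM2r; first by [].
  by rewrite mulr_ge0 // mulr_ge0 ?exprn_ge0 ?invr_ge0.
rewrite -natrX -!natrM ler_nat; apply: leq_trans hW.
by rewrite mulnA leq_mul2l factS leq_pmull ?orbT.
Qed.

End StableSumBounds.

(** * Logarithms of factorials and of the sum over bounded-degree graphs *)

Section LogBounds.
Variable R : realType.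

Lemma ln_exprn (x : R) n : 0 < x -> ln (x ^+ n) = n%:R * ln x.
Proof. by move=> x0; rewrite lnXn // mulr_natl. Qed.

Lemma lnB_le (x y : R) : 0 < x -> 0 < y -> ln x - ln y <= x / y - 1.
Proof.
move=> x0 y0; have h : ln (1 + (x / y - 1)) <= x / y - 1.
  by apply: le_ln1Dx; rewrite ltrBrDl subrr divr_gt0.
by rewrite -ln_div ?posrE // -{1}[x / y](subrKC 1).
Qed.

Lemma ln_nat_ge0 n : 0 <= ln n%:R :> R.
Proof. by case: n => [|n]; [rewrite ln0 | rewrite ln_ge0 // ler1n]. Qed.

(** From n^n / n! <= e^n, one term of the exponential series. *)
Lemma ln_fact_ge n : n%:R * ln n%:R - n%:R <= ln n`!%:R :> R.
Proof.
case: n => [|n]; first by rewrite mul0r subrr ln_nat_ge0.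
have := @exprn_divfact_le_expR R n.+1%:R n.+1 (ler0n _ _).
have f0 : 0 < n.+1`!%:R :> R by rewrite ltr0n fact_gt0.
have n0 : 0 < n.+1%:R :> R by [].
rewrite -ler_ln ?posrE ?expR_gt0 ?divr_gt0 ?exprn_gt0 //.
rewrite ln_div ?posrE ?exprn_gt0 // ln_exprn // expRK; lra.
Qed.

(** For n > 0 this is n! <= e n (n/e)^n. The induction step amounts to (n + 1)(ln n - ln(n + 1)) <=
    -1; n = 0 relies on the default ln 0 = 0. *)
Lemma ln_fact_le n : ln n`!%:R <= n%:R * ln n%:R - n%:R + ln n%:R + 1 :> R.
Proof.
elim: n => [|n IH]; first by rewrite fact0 ln1 ln0 //; lra.
case: n IH => [|n] IH; first by rewrite ln1; lra.
have n0 : 0 < n.+1%:R :> R by [].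
have m0 : 0 < n.+2%:R :> R by [].
have := lnB_le n0 m0.
rewrite [n.+2`!]factS natrM lnM ?posrE ?ltr0n ?fact_gt0 // => h.
have {}h : n.+2%:R * (ln n.+1%:R - ln n.+2%:R) <= -1 :> R.
  have <- : n.+2%:R * (n.+1%:R / n.+2%:R - 1) = -1 :> R.
    by rewrite mulrBr mulrC divfK ?gt_eqF // -!natr1; ring.
  by rewrite ler_pM2l.
move: h IH; rewrite -(natr1 n.+1); set a := n.+1%:R; lra.
Qed.

(** Since ln x = 2 ln (sqrt x). Logarithmic errors are absorbed into multiples of sqrt k in this
    way. *)
Lemma ln_le_sqrt (x : R) : 0 < x -> ln x <= 2 * Num.sqrt x.
Proof.
move=> x0; have s0 : 0 < Num.sqrt x by rewrite sqrtr_gt0.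
rewrite -[in leLHS](sqr_sqrtr (ltW x0)) ln_exprn // ler_pM2l //.
exact/ltW/ln_sublinear.
Qed.

(** The logarithm of (t k lam / e)^(tk/2) t!^(-k), with the power read as 1 when tk = 0. *)
Definition ln_stable_main (lam : R) t k : R :=
  (t * k)%:R / 2 * (ln (t * k)%:R + ln lam - 1) - k%:R * ln t`!%:R.

Section Fixed.
Variables (V : finType) (lam : R) (t : nat) (S : {set V}).
Hypothesis lam0 : 0 < lam.

Lemma stable_sum_gt0 : 0 < stable_sum lam t S.
Proof.
have f0 : 0 < t`!%:R ^+ #|S| :> R by rewrite exprn_gt0 // ltr0n fact_gt0.
rewrite -(pmulr_lgt0 _ f0); apply: lt_le_trans (stable_sum_lower t S 0 lam0).
by rewrite total_weight0 mulr1.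
Qed.

Lemma ln_stable_sum_le (N := (t * #|S|)%N) :
  ln (stable_sum lam t S) <= ln_stable_main lam t #|S|
    + (3 * ln N.+1%:R + 1 + t%:R * Num.sqrt (N.+1%:R / lam)).
Proof.
have N0 : 0 < N.+1%:R :> R by [].
(* This y gives lam y^2 / 2 = (N + 1) / 2, which turns (N + 1)! / y^N into the order (N lam /
   e)^(N/2); the remaining exponent t y is only O(sqrt N). *)
set y := Num.sqrt _.
have y0 : 0 < y by rewrite sqrtr_gt0 divr_gt0.
have y2 : y ^+ 2 = N.+1%:R / lam by rewrite sqr_sqrtr // divr_ge0 // ltW.
have lny : 2 * ln y = ln N.+1%:R - ln lam.
  by rewrite -ln_div ?posrE // -y2 ln_exprn.
have := stable_sum_upper t S lam0 y0; rewrite -/N.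
have f0 : 0 < t`!%:R :> R by rewrite ltr0n fact_gt0.
have F0 : 0 < N.+1`!%:R :> R by rewrite ltr0n fact_gt0.
have Z0 := stable_sum_gt0.
rewrite -ler_ln ?posrE ?mulr_gt0 ?exprn_gt0 ?expR_gt0 //.
rewrite !lnM ?posrE ?mulr_gt0 ?exprn_gt0 ?expR_gt0 // !ln_exprn // expRK.
rewrite y2 [lam * _]mulrC divfK ?gt_eqF //.
have := ln_fact_le N.+1.
(* Passing from ln(N + 1) to ln N in the main term costs at most 1. *)
have : N%:R * (ln N.+1%:R - ln N%:R) <= 1 :> R.
  case E: N => [|M]; first by rewrite mul0r.
  have M0 : 0 < M.+1%:R :> R by [].
  have M1 : 0 < M.+2%:R :> R by [].
  apply: (le_trans (ler_wpM2l (ltW M0) (lnB_le M1 M0))).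
  by rewrite mulrBr mulrC divfK ?gt_eqF // -(natr1 M.+1); lra.
rewrite /ln_stable_main -/N -(natr1 N); set LN1 := ln (N%:R + 1).
have -> : ln y = (LN1 - ln lam) / 2 by move: lny; rewrite -(natr1 N) -/LN1; lra.
set a := N%:R; set L := ln a; set l := ln lam; set k := #|S|%:R.
set Z := ln (stable_sum _ _ _); set T := ln _; set F := ln _.
nra.
Qed.

Lemma ln_stable_sum_ge (N := (t * #|S|)%N) (c := (t + t ^ 2)%N) :
  ln_stable_main lam t #|S|
    - (c%:R / 2 * (ln N%:R + `|ln lam|) + c%:R / 2 + `|ln lam| + 2 + ln N%:R)
  <= ln (stable_sum lam t S).
Proof.
(* A single term suffices, with m as large as [total_weight_ge] allows. Then M - 2m is 0 or 1, so
   the last factorial is 1. *)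
pose M := (N - c)%N; pose m := M./2.
have m2 : (2 * m <= M)%N by rewrite mul2n -[leqRHS]odd_double_half leq_addl.
have Mm : M = (odd M + 2 * m)%N by rewrite mul2n odd_double_half.
have := @total_weight_ge V t S m m2; rewrite -/N -/c -/M.
have -> : (M - 2 * m)`! = 1 by rewrite {1}Mm addnK; case: odd.
rewrite muln1 => hW.
have Z0 := stable_sum_gt0.
have f0 : 0 < t`!%:R :> R by rewrite ltr0n fact_gt0.
have FM0 : 0 < M`!%:R :> R by rewrite ltr0n fact_gt0.
have Fm0 : 0 < m`!%:R :> R by rewrite ltr0n fact_gt0.
have h1 : lam ^+ m * M`!%:R
    <= stable_sum lam t S * t`!%:R ^+ #|S| * (m`!%:R * 2 ^+ m).
  apply: (@le_trans _ _ (lam ^+ m * (total_weight t S m)%:R * (m`!%:R * 2 ^+ m))).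
    rewrite -mulrA ler_pM2l ?exprn_gt0 //.
    by rewrite -natrX -!natrM ler_nat.
  by rewrite ler_wpM2r ?stable_sum_lower // mulr_ge0 // exprn_ge0.
have {}h1 : m%:R * ln lam + ln M`!%:R
    <= ln (stable_sum lam t S) + #|S|%:R * ln t`!%:R + (ln m`!%:R + m%:R * ln 2).
  move: h1; rewrite -ler_ln ?posrE ?mulr_gt0 ?exprn_gt0 //.
  by rewrite !lnM ?posrE ?mulr_gt0 ?exprn_gt0 // !ln_exprn //.
rewrite /ln_stable_main -/N.
have LN0 := ln_nat_ge0 N.
have l0 := normr_ge0 (ln lam).
have l1 := ler_norm (ln lam).
have l2 : - ln lam <= `|ln lam| by rewrite -normrN ler_norm.
have c0 : 0 <= c%:R :> R by [].
(* If M = 0 then N <= c, and the whole main term fits into the error. *)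
have [M0|M0] := posnP M.
  have m0 : m = 0%N by rewrite /m M0.
  move: h1; rewrite m0 M0 fact0 ln1 !mul0r !addr0 => h1.
  have Nc : N%:R <= c%:R :> R by rewrite ler_nat; move/eqP: M0; rewrite subn_eq0.
  have : N%:R / 2 * (ln N%:R + ln lam - 1) <= c%:R / 2 * (ln N%:R + `|ln lam|).
    apply: (@le_trans _ _ (N%:R / 2 * (ln N%:R + `|ln lam|))).
      by rewrite ler_wpM2l //; lra.
    by rewrite ler_wpM2r //; lra.
  lra.
have hM := ln_fact_ge M.
have LM0 := ln_nat_ge0 M.
have hm : ln m`!%:R + m%:R * ln 2 <= m%:R * ln M%:R - m%:R + ln M%:R + 1 :> R.
  case E: m => [|j]; first by rewrite fact0 ln1; lra.
  have := ln_fact_le j.+1.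
  have l20 : 0 <= ln 2 :> R by apply: ln_nat_ge0.
  have : ln j.+1%:R + ln 2 <= ln M%:R :> R.
    rewrite -lnM ?posrE // ler_ln ?posrE ?mulr_gt0 ?ltr0n //.
    by rewrite -natrM ler_nat mulnC -E.
  have : 0 <= j.+1%:R :> R by [].
  set a := j.+1%:R; nra.
have NE : N%:R = M%:R + c%:R :> R by rewrite -natrD subnK // ltnW // -subn_gt0.
have hN : M%:R * (ln N%:R - ln M%:R) <= c%:R :> R.
  have M0' : 0 < M%:R :> R by rewrite ltr0n.
  have N0 : 0 < N%:R :> R by rewrite NE; lra.
  apply: (le_trans (ler_wpM2l (ltW M0') (lnB_le N0 M0'))).
  by rewrite mulrBr mulrC divfK ?gt_eqF // NE; lra.
have LMN : ln M%:R <= ln N%:R :> R.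
  by rewrite ler_ln ?posrE ?ltr0n ?ler_nat ?leq_subr // (leq_trans M0) ?leq_subr.
have ME : M%:R = (odd M)%:R + 2 * m%:R :> R by rewrite -natrM -natrD -Mm.
(* The cost of rounding M / 2 down to m. *)
have dl : - `|ln lam| / 2 <= - (odd M)%:R / 2 * ln lam /\
    - 1 / 2 <= (odd M)%:R / 2 * (ln M%:R - 1) :> R.
  have [->|->] : (odd M)%:R = 0 :> R \/ (odd M)%:R = 1 :> R.
    by case: odd; [right | left].
    by split; lra.
  by split; lra.
have : c%:R / 2 * (ln N%:R + ln lam - 1) <= c%:R / 2 * (ln N%:R + `|ln lam|).
  by rewrite ler_wpM2l //; lra.
move: dl l0 LMN h1 hM hm hN ME => [dl1 dl2] l0' LMN h1 hM hm hN ME h2.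
have {}ME : m%:R = (M%:R - (odd M)%:R) / 2 :> R by lra.
move: h1 hm LMN hN h2; rewrite ME NE => h1 hm LMN hN h2.
lra.
Qed.

End Fixed.

(** C depends on lam and t only, so one bound serves all k-subsets for all n. The errors are
    multiples of sqrt(N + 1), which is at most sqrt(t + 1) sqrt k because k >= 1. *)
Lemma ln_stable_sum_bound (lam : R) t : 0 < lam -> exists C : R, 0 <= C /\
  forall (V : finType) (S : {set V}), (0 < #|S|)%N ->
  `|ln (stable_sum lam t S) - ln_stable_main lam t #|S| | <= C * Num.sqrt #|S|%:R.
Proof.
move=> lam0.
pose c : R := (t + t ^ 2)%N%:R.
(* C1 and C2 collect the upper and lower errors by ln <= 2s and 1 <= s with s = sqrt(N + 1): 7 = 3 *
   2 + 1 and 4 = 2 + 2. *)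
pose C1 : R := 7 + t%:R * Num.sqrt lam^-1.
pose C2 : R := c / 2 * (2 + `|ln lam|) + c / 2 + `|ln lam| + 4.
have C10 : 0 <= C1 by rewrite addr_ge0 // mulr_ge0 ?sqrtr_ge0.
have C20 : 0 <= C2 by rewrite /C2 !addr_ge0 // !mulr_ge0 // addr_ge0.
exists ((C1 + C2) * Num.sqrt t.+1%:R); split.
  by rewrite mulr_ge0 ?sqrtr_ge0 // addr_ge0.
move=> V S S0; set N := (t * #|S|)%N; set s := Num.sqrt N.+1%:R : R.
have s1 : 1 <= s by rewrite -[leLHS]sqrtr1 ler_wsqrtr // ler1n.
have ss : s <= Num.sqrt t.+1%:R * Num.sqrt #|S|%:R.
  by rewrite -sqrtrM // ler_wsqrtr // -natrM ler_nat mulSn /N; lia.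
rewrite -mulrA.
apply: (@le_trans _ _ ((C1 + C2) * s)); last first.
  by rewrite ler_wpM2l // addr_ge0.
have LN1 : ln N.+1%:R <= 2 * s by apply: ln_le_sqrt.
have LN : ln N%:R <= 2 * s.
  apply: le_trans LN1; case: (N) => [|M]; first by rewrite ln0 // ln1.
  by rewrite ler_ln ?posrE // ler_nat.
have /= := ln_stable_sum_le t S lam0; have /= := ln_stable_sum_ge t S lam0.
rewrite -/N -/c sqrtrM // -/s; set v := Num.sqrt lam^-1.
have v0 : 0 <= v by rewrite sqrtr_ge0.
set X := ln (stable_sum _ _ _); set Y := ln_stable_main _ _ _ => lo up.
have h1 : 3 * ln N.+1%:R + 1 + t%:R * (s * v) <= C1 * s.
  by rewrite /C1 -/v; lra.
have c0 : 0 <= c by rewrite /c.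
have h2 : c / 2 * (ln N%:R + `|ln lam|) + c / 2 + `|ln lam| + 2 + ln N%:R <= C2 * s.
  have a0 := normr_ge0 (ln lam).
  have e1 : `|ln lam| <= `|ln lam| * s by rewrite ler_peMr.
  have e2 : c / 2 * (ln N%:R + `|ln lam|) <= c / 2 * ((2 + `|ln lam|) * s).
    by rewrite ler_wpM2l ?divr_ge0 //; lra.
  have e3 : c / 2 <= c / 2 * s by rewrite ler_peMr ?divr_ge0.
  rewrite /C2; lra.
rewrite ler_norml; apply/andP; split.
  have : 0 <= C1 * s by rewrite mulr_ge0 //; lra.
  lra.
have : 0 <= C2 * s by rewrite mulr_ge0 //; lra.
lra.
Qed.

End LogBounds.

(** * Falling factorials and binomial coefficients *)

Lemma ffact_le n m : (n ^_ m <= n ^ m)%N.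
Proof.
elim: m => // m IH.
by rewrite ffactnSr expnSr leq_mul // leq_subr.
Qed.

(** Used for m = k; separating m from k keeps the base n - k fixed during the induction. *)
Lemma ffact_ge n k m : (m <= k)%N -> ((n - k) ^ m <= n ^_ m)%N.
Proof.
elim: m => // m IH mk; rewrite ffactnSr expnSr leq_mul ?IH //; first by rewrite ltnW.
by rewrite leq_sub2l // ltnW.
Qed.

Section Asymptotics.
Variable R : realType.

(** From (n - k)^k <= 'C(n, k) k! <= n^k. The first error is ln n - ln(n - k) <= k / (n - k) <= 2k /
    n, taken k times; 3 sqrt k covers the error ln k + 1 of the factorial. *)
Lemma ln_bin_bound n k : (0 < k)%N -> (2 * k <= n)%N ->
  `|ln 'C(n, k)%:R - k%:R * (1 + ln n%:R - ln k%:R) |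
  <= k%:R * (2 * (k%:R / n%:R)) + 3 * Num.sqrt k%:R :> R.
Proof.
move=> k0 kn.
have kn' : (k < n)%N by rewrite (leq_trans _ kn) // mul2n -addnn -{1}[k]addn0 ltn_add2l.
have C0 : 0 < 'C(n, k)%:R :> R by rewrite ltr0n bin_gt0 ltnW.
have F0 : 0 < k`!%:R :> R by rewrite ltr0n fact_gt0.
have n0 : 0 < n%:R :> R by rewrite ltr0n (leq_trans k0) // ltnW.
have d0 : 0 < (n - k)%:R :> R by rewrite ltr0n subn_gt0.
have kR : 0 < k%:R :> R by rewrite ltr0n.
have up : ln 'C(n, k)%:R + ln k`!%:R <= k%:R * ln n%:R :> R.
  rewrite -lnM ?posrE // -ln_exprn // ler_ln ?posrE ?mulr_gt0 ?exprn_gt0 //.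
  by rewrite -natrM -natrX ler_nat bin_ffact ffact_le.
have lo : k%:R * ln (n - k)%:R <= ln 'C(n, k)%:R + ln k`!%:R :> R.
  rewrite -lnM ?posrE // -ln_exprn // ler_ln ?posrE ?mulr_gt0 ?exprn_gt0 //.
  by rewrite -natrM -natrX ler_nat bin_ffact ffact_ge.
have s0 : 0 < Num.sqrt k%:R :> R by rewrite sqrtr_gt0.
have s1 : 1 <= Num.sqrt k%:R :> R by rewrite -[leLHS]sqrtr1 ler_wsqrtr // ler1n.
have lk := ln_le_sqrt kR.
have d : k%:R * (ln n%:R - ln (n - k)%:R) <= k%:R * (2 * (k%:R / n%:R)) :> R.
  rewrite ler_pM2l //; apply: le_trans (lnB_le n0 d0) _.
  have dn : n%:R <= 2 * (n - k)%:R :> R by rewrite -natrM ler_nat; lia.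
  have -> : n%:R / (n - k)%:R - 1 = k%:R / (n - k)%:R :> R.
    rewrite -[in LHS](subnK (ltnW kn')) natrD addnK mulrDl mulfV ?gt_eqF //.
    by rewrite addrAC subrr add0r.
  rewrite mulrCA ler_pM2l // -[leRHS]invrK lef_pV2 ?posrE ?invr_gt0 ?mulr_gt0 ?invr_gt0 //.
  by rewrite invfM invrK ler_pdivrMl.
have fl := ln_fact_ge R k; have fu := ln_fact_le R k.
have p0 : 0 <= k%:R * (2 * (k%:R / n%:R)) :> R.
  by rewrite !mulr_ge0 // invr_ge0.
by rewrite ler_norml; apply/andP; split; lra.
Qed.

Lemma cvg_inv_sqrt : (Num.sqrt n%:R : R)^-1 @[n --> \oo] --> (0 : R).
Proof.
apply/gtr0_cvgV0; first by near=> n; rewrite sqrtr_gt0 ltr0n; near: n; exact: nbhs_infty_gt.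
apply/cvgryPge => A; near=> n.
apply: le_trans (ler_norm A) _; rewrite -sqrtr_sqr ler_wsqrtr //.
by near: n; exact: nbhs_infty_ger.
Unshelve. all: by end_near. Qed.

(** The quantity whose power k/2 appears in the theorem, with b written out as 1 / (1 - p). *)
Definition base (p : R) t n k : R :=
  expR 1 ^+ 2 * n%:R ^+ 2 * (1 / (1 - p)) ^ (- k%:Z + 1) * k%:R ^ (t%:Z - 2)
  * (t%:R * (1 / (1 - p)) * p / expR 1) ^+ t * (1 / t`!%:R ^+ 2).

Lemma ln_exprz (x : R) (z : int) : 0 < x -> ln (x ^ z) = z%:~R * ln x.
Proof. by move=> x0; rewrite -powR_intmul ?ln_powR // ltW. Qed.

(** * The main term and its comparison with the expectation *)

Section Base.
Variables (p : R) (t n k : nat).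
Hypotheses (hp : 0 < p < 1) (n0 : (0 < n)%N) (k0 : (0 < k)%N).

Let p0 : 0 < p. Proof. by case/andP: hp. Qed.
Let q0 : 0 < 1 - p. Proof. by case/andP: hp; rewrite subr_gt0. Qed.
Let nR : 0 < n%:R :> R. Proof. by rewrite ltr0n. Qed.
Let kR : 0 < k%:R :> R. Proof. by rewrite ltr0n. Qed.
Let fR : 0 < t`!%:R :> R. Proof. by rewrite ltr0n fact_gt0. Qed.

Let factor_gt0 : 0 < (t%:R * (1 / (1 - p)) * p / expR 1) ^+ t.
Proof.
(* For t = 0 the bracket is 0, but its power is 0^0 = 1. *)
case: t => [|s]; first by rewrite expr0.
by rewrite exprn_gt0 // divr_gt0 ?expR_gt0 // !mulr_gt0 ?invr_gt0.
Qed.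

Let ln_factor : ln ((t%:R * (1 / (1 - p)) * p / expR 1) ^+ t)
  = t%:R * (ln t%:R + ln (p / (1 - p)) - 1).
Proof.
case: t => [|s]; first by rewrite expr0 ln1 mul0r.
have b0 : 0 < p / (1 - p) by rewrite divr_gt0.
have -> : s.+1%:R * (1 / (1 - p)) * p / expR 1 = s.+1%:R * (p / (1 - p)) / expR 1.
  by congr (_ / _); rewrite -mulrA div1r [p / _]mulrC.
have a0 : 0 < s.+1%:R * (p / (1 - p)) by rewrite mulr_gt0.
rewrite ln_exprn ?divr_gt0 ?expR_gt0 //; congr (_ * _).
by rewrite ln_div ?posrE ?expR_gt0 // lnM ?posrE // expRK.
Qed.

Lemma base_gt0 : 0 < base p t n k.
Proof.
by rewrite /base !mulr_gt0 ?factor_gt0 ?exprz_gt0 ?invr_gt0 ?exprn_gt0 ?expR_gt0 ?divr_gt0.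
Qed.

(** An exact splitting: e^2 n^2 k^(-2) yields (en/k)^k, the power of b yields (1 - p)^'C(k, 2), and
    k^t with the factors in t yields the main term of [stable_sum]. *)
Lemma ln_base : k%:R / 2 * ln (base p t n k)
  = k%:R * (1 + ln n%:R - ln k%:R) + 'C(k, 2)%:R * ln (1 - p)
    + ln_stable_main (p / (1 - p)) t k.
Proof.
rewrite /base !lnM ?posrE ?mulr_gt0 ?factor_gt0 ?exprz_gt0 ?invr_gt0 ?exprn_gt0 ?expR_gt0 ?divr_gt0 //.
rewrite ln_factor !div1r lnV ?posrE ?exprn_gt0 // !ln_exprz ?invr_gt0 //.
rewrite !ln_exprn ?expR_gt0 // expRK lnV ?posrE // /ln_stable_main.
have -> : 'C(k, 2)%:R = k%:R * (k%:R - 1) / 2 :> R.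
  have E : ('C(k, 2) * 2)%N = (k * k.-1)%N.
    by rewrite -[X in (_ * X)%N]/(2`!) bin_ffact ffactnS ffactn1.
  have kE : k%:R = k.-1%:R + 1 :> R by rewrite natr1 prednK.
  by rewrite {2}kE addrK -natrM -E natrM mulfK.
have -> : (t * k)%:R / 2 * (ln (t * k)%:R + ln (p / (1 - p)) - 1)
    = k%:R / 2 * (t%:R * (ln t%:R + ln k%:R + ln (p / (1 - p)) - 1)) :> R.
  (* ln(tk) = ln t + ln k fails for t = 0, where both sides vanish by their prefactor. *)
  case: (t) => [|s]; first by rewrite mul0n !mul0r mulr0.
  by rewrite natrM (@lnM _ s.+1%:R) ?posrE //; ring.
by rewrite ln1 !intrD !mulrNz -!pmulrn; field.
Qed.

End Base.

(** All 'C(n, k) summands share the same bounds, so the errors of [ln_bin_bound] and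
    [ln_stable_sum_bound] add up. The exponent d is written with a factor k because a k-th root is
    taken later. *)
Lemma expectation_bounds (p : R) t : 0 < p < 1 -> exists C : R,
  forall n k (d := k%:R * (2 * (k%:R / n%:R) + C * (Num.sqrt k%:R)^-1))
    (E := gnp_expectation p (fun G : graph 'I_n => (alpha t k G)%:R)),
  (0 < k)%N -> (2 * k <= n)%N ->
  base p t n k `^ (k%:R / 2) * expR (- d) <= E
    <= base p t n k `^ (k%:R / 2) * expR d.
Proof.
move=> hp; have /andP[p0 p1] := hp.
have q0 : 0 < 1 - p by rewrite subr_gt0.
have lam0 : 0 < p / (1 - p) by rewrite divr_gt0.
have [C [C0 hC]] := ln_stable_sum_bound t lam0.
(* The 3 pays for the 3 sqrt k of the binomial coefficient. *)
exists (C + 3) => n k d E k0 kn.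
have n0 : (0 < n)%N by rewrite (leq_trans k0) // (leq_trans _ kn) // leq_pmull.
have kn' : (k <= n)%N by rewrite (leq_trans _ kn) // leq_pmull.
have C0' : 0 < 'C(n, k)%:R :> R by rewrite ltr0n bin_gt0.
have b0 := base_gt0 t hp n0 k0.
have kR : 0 < k%:R :> R by rewrite ltr0n.
have s0 : 0 < Num.sqrt k%:R :> R by rewrite sqrtr_gt0.
have dE : d = k%:R * (2 * (k%:R / n%:R)) + (C + 3) * Num.sqrt k%:R.
  rewrite /d mulrDr; congr (_ + _); rewrite mulrCA; congr (_ * _).
  by rewrite -{1}(sqr_sqrtr (ltW kR)) expr2 mulfK // gt_eqF.
rewrite /powR gt_eqF // (ln_base t hp n0 k0) -!expRD.
set main := ln_stable_main _ _ _.
have -> : E = \sum_(S : {set 'I_n} | #|S| == k)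
      (1 - p) ^+ 'C(k, 2) * stable_sum (p / (1 - p)) t S.
  exact: expectation_alpha.
have card (x : R) : \sum_(S : {set 'I_n} | #|S| == k) x = 'C(n, k)%:R * x.
  rewrite sumr_const mulr_natl; congr (_ *+ _).
  by rewrite -[n in 'C(n, _)]card_ord -card_draws; apply: eq_card => S; rewrite !inE.
have qE : (1 - p) ^+ 'C(k, 2) = expR ('C(k, 2)%:R * ln (1 - p)).
  by rewrite expRM_natl lnK ?posrE.
have /ler_normlP[] := ln_bin_bound k0 kn.
set u := ln _; set w := k%:R * (1 + _ - _) => lo up.
have uE : 'C(n, k)%:R = expR u by rewrite /u lnK ?posrE.
have hS (S : {set 'I_n}) : #|S| == k ->
    `|ln (stable_sum (p / (1 - p)) t S) - main | <= C * Num.sqrt k%:R.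
  by move=> /eqP Sk; have := hC _ S; rewrite Sk; apply.
apply/andP; split.
  apply: (@le_trans _ _ (\sum_(S : {set 'I_n} | #|S| == k)
    (1 - p) ^+ 'C(k, 2) * expR (main - C * Num.sqrt k%:R))).
    rewrite card qE uE -!expRD ler_expR dE; lra.
  apply: ler_sum => S Sk; rewrite ler_pM2l ?exprn_gt0 //.
  rewrite -ler_ln ?posrE ?expR_gt0 ?stable_sum_gt0 // expRK.
  by have /ler_normlP[] := hS S Sk; lra.
apply: (@le_trans _ _ (\sum_(S : {set 'I_n} | #|S| == k)
    (1 - p) ^+ 'C(k, 2) * expR (main + C * Num.sqrt k%:R))); last first.
  rewrite card qE uE -!expRD ler_expR dE; lra.
apply: ler_sum => S Sk; rewrite ler_pM2l ?exprn_gt0 //.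
rewrite -ler_ln ?posrE ?expR_gt0 ?stable_sum_gt0 // expRK.
by have /ler_normlP[] := hS S Sk; lra.
Qed.

(** * Consequences of k = O(ln n) *)

Lemma cvg_logarithmic_div_id (k : nat -> nat) :
  (fun n : nat => (k n)%:R : R^o) =O_\oo (fun n : nat => ln n%:R : R^o) ->
  ((k n)%:R / n%:R : R) @[n --> \oo] --> (0 : R).
Proof.
move=> /eqOP hO.
have [C [C0 hC]] : exists C : R, 0 <= C /\
    \forall n \near \oo, `|(k n)%:R : R| <= C * `|ln n%:R : R|.
  have [A [Ar hA]] := hO.
  exists (`|A| + 1); split; first by rewrite addr_ge0.
  by apply: hA; rewrite ltr_pwDr // ler_norm.
(* Since ln n <= 2 sqrt n, the quotient k / n is O(1 / sqrt n). *)
apply: (@squeeze_cvgr _ _ _ _ (fun=> 0) (fun n : nat => C * 4 * (Num.sqrt n%:R : R)^-1)).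
- near=> n; apply/andP; split; first by rewrite divr_ge0.
  have n0 : (0 < n)%N by near: n; exact: nbhs_infty_gt.
  have nR : 0 < n%:R :> R by rewrite ltr0n.
  have hk : `|(k n)%:R : R| <= C * `|ln n%:R : R| by near: n.
  have s0 : 0 < Num.sqrt n%:R :> R by rewrite sqrtr_gt0.
  rewrite ler_pdivrMr // -[X in _ <= _ * X](sqr_sqrtr (ltW nR)).
  rewrite expr2 -!mulrA mulKf ?gt_eqF //.
  move: hk; rewrite ger0_norm // => /le_trans; apply.
  rewrite ler_wpM2l // ger0_norm ?ln_nat_ge0 //.
  by have := ln_le_sqrt nR; lra.
- exact: cvg_cst.
- rewrite -[X in _ --> X](mulr0 (C * 4)); apply: cvgMl_tmp; exact: cvg_inv_sqrt.
Unshelve. all: by end_near. Qed.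

End Asymptotics.

(** * Extraction of the factor (1 + o(1))^k *)

Theorem theorem2 (R : realType) (p : R) (t : nat) (k : nat -> nat)
  (hp : 0 < p < 1)
  (hk_pos : forall n : nat, (0 < n)%N -> (0 < k n)%N)
  (hk_O : (fun n : nat => (k n)%:R : R^o) =O_\oo (fun n : nat => ln n%:R : R^o))
  (hk_oo : k n @[n --> \oo] --> \oo) :
  let b : R := 1 / (1 - p) in
  let e : R := expR 1 in
  exists eps : nat -> R,
    (eps n @[n --> \oo] --> (0 : R)) /\
    forall n : nat, (0 < n)%N ->
      gnp_expectation p (fun G : graph 'I_n => (alpha t (k n) G)%:R)
      = (e ^+ 2 * n%:R ^+ 2 * b ^ (- (k n)%:Z + 1) * (k n)%:R ^ (t%:Z - 2)
           * (t%:R * b * p / e) ^+ t * (1 / (t`!)%:R ^+ 2))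
          `^ ((k n)%:R / 2)
        * (1 + eps n) ^+ k n.
Proof.
move=> b e.
pose E n := gnp_expectation p (fun G : graph 'I_n => (alpha t (k n) G)%:R).
pose B n := base p t n (k n).
pose Q n := E n / B n `^ ((k n)%:R / 2).
have [C hC] := expectation_bounds t hp.
pose eta n : R := 2 * ((k n)%:R / n%:R) + C * (Num.sqrt (k n)%:R)^-1.
have eta0 : eta n @[n --> \oo] --> (0 : R).
  have -> : 0 = 2 * 0 + C * 0 :> R by rewrite !mulr0 addr0.
  apply: cvgD; apply: cvgMl_tmp; first exact: (cvg_logarithmic_div_id hk_O).
  exact: (cvg_comp _ _ hk_oo (@cvg_inv_sqrt R)).
(* The k-th root of the ratio [Q n] makes the equation exact for every n >= 1; only the convergence
   to 0 needs large n. *)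
exists (fun n => Q n `^ (k n)%:R^-1 - 1); split.
  have e1 : expR (- eta n) - 1 @[n --> \oo] --> (0 : R).
    have -> : 0 = expR (- 0) - 1 :> R by rewrite oppr0 expR0 subrr.
    apply: cvgB; last exact: cvg_cst.
    by apply: continuous_cvg; [exact: continuous_expR | exact: cvgN].
  have e2 : expR (eta n) - 1 @[n --> \oo] --> (0 : R).
    have -> : 0 = expR 0 - 1 :> R by rewrite expR0 subrr.
    apply: cvgB; last exact: cvg_cst.
    by apply: continuous_cvg; [exact: continuous_expR |].
  (* [Q n] lies between exp(-k eta) and exp(k eta), so its k-th root lies between exp(-eta) and
     exp(eta). *)
  apply: squeeze_cvgr e1 e2; near=> n.
  have n0 : (0 < n)%N by near: n; exact: nbhs_infty_gt.
  have k0 := hk_pos n n0.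
  have kR : 0 < (k n)%:R :> R by rewrite ltr0n.
  (* Holds eventually, as k / n tends to 0. *)
  have kn : (2 * k n <= n)%N.
    have : (k n)%:R / n%:R < 2^-1 :> R.
      near: n; apply: (cvgr_lt (0 : R)); first exact: (cvg_logarithmic_div_id hk_O).
      by rewrite invr_gt0.
    rewrite ltr_pdivrMr ?ltr0n // mulrC ltr_pdivlMr // -natrM ltr_nat mulnC.
    exact: ltnW.
  have /andP[lo up] := hC n (k n) k0 kn.
  have B0 : 0 < B n `^ ((k n)%:R / 2) by rewrite powR_gt0 // base_gt0.
  have root (x : R) : expR ((k n)%:R * x) `^ (k n)%:R^-1 = expR x.
    by rewrite -expRM mulrAC mulfV ?mul1r // gt_eqF.
  rewrite !lerD2r -(root (eta n)) -(root (- eta n)) mulrN; apply/andP; split.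
    rewrite ge0_ler_powR ?nnegrE ?invr_ge0 ?expR_ge0 //.
      by rewrite divr_ge0 ?(ltW B0) // (le_trans _ lo) // mulr_ge0 ?expR_ge0 ?(ltW B0).
    by rewrite ler_pdivlMr // mulrC.
  rewrite ge0_ler_powR ?nnegrE ?invr_ge0 ?expR_ge0 //.
    by rewrite divr_ge0 ?(ltW B0) // (le_trans _ lo) // mulr_ge0 ?expR_ge0 ?(ltW B0).
  by rewrite ler_pdivrMr // mulrC.
move=> n n0; have k0 := hk_pos n n0.
have B0 : 0 < B n `^ ((k n)%:R / 2) by rewrite powR_gt0 // base_gt0.
have E0 : 0 <= E n.
  rewrite /E /gnp_expectation sumr_ge0 // => G _; rewrite mulr_ge0 // gnp_ge0 //.
  by case/andP: hp => /ltW-> /ltW->.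
have Q0 : 0 <= Q n by rewrite divr_ge0 // ltW.
have QE : (Q n `^ (k n)%:R^-1) ^+ k n = Q n.
  rewrite -powR_mulrn ?powR_ge0 // -powRrM mulVf ?pnatr_eq0 -?lt0n //.
  by rewrite powRr1.
by rewrite subrKC QE -/(E n) -/(base p t n (k n)) -/(B n) mulrC divfK // gt_eqF.
Unshelve. all: by end_near. Qed.
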